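(* Let $(\mathbf{C},\mathcal M)$ be an $\mathcal M$-adhesive category with a unique $\mathcal E'$–$\mathcal M$ pair factorization and binary coproducts, such that the corresponding plain system has initial transformation pairs for conflicts. Let $\langle\rho_1,\rho_2\rangle$ be a rule pair whose set $\mathcal S$ of initial conflicts consists only of regular initial conflicts. Then $\bigcup_{stp\in\mathcal S}\mathcal U^D(stp)$ is $\mathcal M$-complete with respect to parallel dependence. Moreover, $\bigcup_{stp\in\mathcal S}\mathcal U^D(stp)$ is finite if $\mathcal S$ is finite.
   Context: $\mathcal M$-adhesive category: category with a distinguished class $\mathcal M$ of monomorphisms satisfying the standard axioms (including the van Kampen property). Unique $\mathcal E'$–$\mathcal M$ pair factorization: every pair $f_1\colon A_1\to B$, $f_2\colon A_2\to B$ factors uniquely up to isomorphism as $f_j=m\circ e_j$ with $(e_1,e_2)\in\mathcal E'$, $m\in\mathcal M$. ACs over $P$: $\exists(a,ac_C)$ for $a\colon P\to C$ and an AC $ac_C$ over $C$; negations, finite conjunctions, and (derived) finite disjunctions (empty conjunction $=\mathrm{true}$; $\mathrm{false}=\neg\mathrm{true}$). $p\colon P\to G$ satisfies $\exists(a,ac_C)$ iff there is $q\colon C\to G$ in $\mathcal M$ with $q\circ a=p$ and $q\models ac_C$. Two ACs are equivalent if satisfied by the same morphisms. $\mathrm{Shift}(b,ac_P)$ for $b\colon P\to P'$ denotes an AC over $P'$ with $n\models\mathrm{Shift}(b,ac_P)\iff n\circ b\models ac_P$. For a span $p^*=(K\leftarrow D\rightarrow P)$ of $\mathcal M$-morphisms,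 $\mathrm{Left}(p^*,ac_P)$ denotes an AC over $K$ with $m\models\mathrm{Left}(p^*,ac_P)\iff m^*\models ac_P$ for every double pushout transformation via $p^*$ with match $m$, comatch $m^*$. Rule $\rho=\langle p,ac_L\rangle$: plain rule $p=(L\leftarrow I\rightarrow R)$ with $\mathcal M$-morphisms and an AC over $L$. AC-disregarding direct transformation: double pushout for $p$ with match $m$ (intermediate $D$, $k\colon D\to G$, $c\colon D\to H$); direct transformation: additionally $m\models ac_L$. A pair $H_1\Leftarrow_{\rho_1,m_1}G\Rightarrow_{\rho_2,m_2}H_2$ is parallel independent if there are $d_{12}\colon L_1\to D_2$ with $k_2\circ d_{12}=m_1$, $c_2\circ d_{12}\models ac_{L_1}$, and $d_{21}\colon L_2\to D_1$ with $k_1\circ d_{21}=m_2$, $c_1\circ d_{21}\models ac_{L_2}$ (for plain rules, without AC requirements); else parallel dependent (a conflict). Embedding via extension morphism $m\colon K\to G$: $m_j=m\circ o_j$ and the double pushout diagrams are connected by morphisms forming commuting pushout squares. A set of transformation pairs via $\rho_1,\rho_2$ is $\mathcal M$-complete w.r.t. parallel dependence if each parallel dependent pair of direct transformations admits a pair from the set embedding into it via an extension morphism in $\mathcal M$. Symbolic transformation pair $stp_K=\langle tp_K,ac_K,ac^*_K\rangle$: $tp_K\colon P_1\Leftarrow_{\rho_1,o_1}K\Rightarrow_{\rho_2,o_2}P_2$ a pair of AC-disregarding transformations with spans $p^*_j=(K\xleftarrow{k_j}D_j\xrightarrow{c_j}P_j)$; $ac_K=\mathrm{Shift}(o_1,ac_{L_1})\wedge\mathrm{Shift}(o_2,ac_{L_2})$;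 $ac^*_K=\neg(ac^*_{K,d_{12}}\wedge ac^*_{K,d_{21}})$ with $ac^*_{K,d_{12}}=\mathrm{Left}(p^*_2,\mathrm{Shift}(c_2\circ d_{12},ac_{L_1}))$ if some $d_{12}$ with $k_2\circ d_{12}=o_1$ exists, else $\mathrm{false}$; symmetrically for $ac^*_{K,d_{21}}$. Unfolding: all pairs of direct transformations into which $tp_K$ embeds via some extension morphism; conflict-inducing: unfolding contains a parallel dependent pair. Plain initial transformation pair: $tp^I$ is initial for plain $tp$ if it embeds into $tp$ via $f^I$ and for every $tp'$ embedding into $tp$ via $f$ there is a unique embedding $f'^I$ of $tp^I$ into $tp'$ with $f\circ f'^I=f^I$. The system has initial transformation pairs for conflicts if every conflicting plain pair has one; a plain initial conflict is a conflicting plain pair isomorphic to its initial transformation pair. $tp_{L_1+L_2}\colon R_1+L_2\Leftarrow_{p_1,i_1}L_1+L_2\Rightarrow_{p_2,i_2}L_1+R_2$ (coproduct injections) is the initial parallel independent transformation pair. Initial conflict for $\langle\rho_1,\rho_2\rangle$: a conflict-inducing symbolic transformation pair whose AC-disregarding pair is either a plain initial conflict for $p_1,p_2$ or (isomorphic to) $tp_{L_1+L_2}$. Regular initial conflict and disjunctive unfolding: an initial conflict $stp_K$ is regular if $ac_K\wedge ac^*_K$ is equivalent to $\bigvee_{i\in I}\exists(a_i\colon K\to C_i,c_i)$ with $I$ a non-empty finite index set and each $c_i=\bigwedge_{j\in J}\neg\exists(b_j\colon C_i\to C_j,d_j)$ an AC over $C_i$ with all $b_j$ non-isomorphisms. For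 such a representation, the disjunctive unfolding $\mathcal U^D(stp_K)$ is the set of pairs $tp_{C_i}\colon D_{1,i}\Leftarrow_{\rho_1,a_i\circ o_1}C_i\Rightarrow_{\rho_2,a_i\circ o_2}D_{2,i}$, $i\in I$ (for those $i$ for which these transformations exist). *)

(* Defs.v *)
From mathcomp Require Import all_boot.
From mathcomp Require Import boolp classical_sets functions cardinality.

Set Implicit Arguments.
Unset Strict Implicit.
Unset Printing Implicit Defensive.

Local Open Scope classical_set_scope.

(** * Categories *)

Record category := Category {
  obj :> Type;
  hom : obj -> obj -> Type;
  idm : forall A, hom A A;
  comp : forall A B D, hom B D -> hom A B -> hom A D;
  comp1m : forall A B (f : hom A B), comp (idm B) f = f;
  compm1 : forall A B (f : hom A B), comp f (idm A) = f;
  compA : forall A B D E (h : hom D E) (g : hom B D) (f : hom A B),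
    comp h (comp g f) = comp (comp h g) f
}.

Arguments hom {c} A B.
Arguments idm {c} A.
Arguments comp {c A B D} g f.

Notation "g \c f" := (comp g f) (at level 40, left associativity).

Section Limits.
Variable C : category.

Definition is_mono (A B : C) (f : hom A B) : Prop :=
  forall X (u v : hom X A), f \c u = f \c v -> u = v.

Definition is_iso (A B : C) (f : hom A B) : Prop :=
  exists g : hom B A, g \c f = idm A /\ f \c g = idm B.

(* [is_pushout f g f' g']: square  A -f-> B,  A -g-> D,  B -f'-> E,  D -g'-> E. *)
Definition is_pushout (A B D E : C)
    (f : hom A B) (g : hom A D) (f' : hom B E) (g' : hom D E) : Prop :=
  f' \c f = g' \c g /\
  forall X (u : hom B X) (v : hom D X), u \c f = v \c g ->
    exists! w : hom E X, w \c f' = u /\ w \c g' = v.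

(* [is_pullback f g f' g']: the same square, with [A] the pullback object. *)
Definition is_pullback (A B D E : C)
    (f : hom A B) (g : hom A D) (f' : hom B E) (g' : hom D E) : Prop :=
  f' \c f = g' \c g /\
  forall X (u : hom X B) (v : hom X D), f' \c u = g' \c v ->
    exists! w : hom X A, f \c w = u /\ g \c w = v.

(* Van Kampen property of the bottom square (f, g, f', g'), restricted to
   cubes whose vertical morphisms b, d, e belong to [M]:  top square
   (tf, tg, tf', tg') over objects A', B', D', E'; back faces over f and g;
   front faces over f' and g'. *)
Definition is_VK (M : forall A B : C, set (hom A B)) (A B D E : C)
    (f : hom A B) (g : hom A D) (f' : hom B E) (g' : hom D E) : Prop :=
  forall (A' B' D' E' : C)
    (tf : hom A' B') (tg : hom A' D') (tf' : hom B' E') (tg' : hom D' E')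
    (a : hom A' A) (b : hom B' B) (d : hom D' D) (e : hom E' E),
  M _ _ b -> M _ _ d -> M _ _ e ->
  tf' \c tf = tg' \c tg ->
  f' \c b = e \c tf' -> g' \c d = e \c tg' ->
  is_pullback a tf f b -> is_pullback a tg g d ->
  is_pushout tf tg tf' tg' <->
  is_pullback b tf' f' e /\ is_pullback d tg' g' e.

Record binary_coproducts := BinaryCoproducts {
  coprod : C -> C -> C;
  inl_ : forall A B, hom A (coprod A B);
  inr_ : forall A B, hom B (coprod A B);
  copair : forall A B X, hom A X -> hom B X -> hom (coprod A B) X;
  copair_inl : forall A B X (u : hom A X) (v : hom B X),
    copair u v \c inl_ A B = u;
  copair_inr : forall A B X (u : hom A X) (v : hom B X),
    copair u v \c inr_ A B = v;
  copair_uniq : forall A B X (w : hom (coprod A B) X),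
    w = copair (w \c inl_ A B) (w \c inr_ A B)
}.

Definition coprod_map (cp : binary_coproducts) (A A' B B' : C)
    (f : hom A A') (g : hom B B') : hom (coprod cp A B) (coprod cp A' B') :=
  copair cp (inl_ cp A' B' \c f) (inr_ cp A' B' \c g).

Lemma copair_ext (cp : binary_coproducts) (A B X : C)
    (w w' : hom (coprod cp A B) X) :
  w \c inl_ cp A B = w' \c inl_ cp A B ->
  w \c inr_ cp A B = w' \c inr_ cp A B -> w = w'.
Proof.
by move=> hl hr; rewrite (copair_uniq w) (copair_uniq w') hl hr.
Qed.

Lemma pushout_inl (cp : binary_coproducts) (A A' B : C) (f : hom A A') :
  is_pushout f (inl_ cp A B) (inl_ cp A' B) (coprod_map cp f (idm B)).
Proof.
split; first by rewrite /coprod_map copair_inl.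
move=> X u v huv; exists (copair cp u (v \c inr_ cp A B)); split.
  split; first by rewrite copair_inl.
  apply: copair_ext; rewrite -compA /coprod_map.
    by rewrite copair_inl compA copair_inl.
  by rewrite copair_inr compA copair_inr compm1.
move=> w [<- <-]; apply: copair_ext; first by rewrite copair_inl.
by rewrite copair_inr -compA /coprod_map copair_inr compm1.
Qed.

Lemma pushout_inr (cp : binary_coproducts) (A B B' : C) (g : hom B B') :
  is_pushout g (inr_ cp A B) (inr_ cp A B') (coprod_map cp (idm A) g).
Proof.
split; first by rewrite /coprod_map copair_inr.
move=> X u v huv; exists (copair cp (v \c inl_ cp A B) u); split.
  split; first by rewrite copair_inr.
  apply: copair_ext; rewrite -compA /coprod_map.
    by rewrite copair_inl compA copair_inl compm1.
  by rewrite copair_inr compA copair_inr.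
move=> w [<- <-]; apply: copair_ext; last by rewrite copair_inr.
by rewrite copair_inl -compA /coprod_map copair_inl compm1.
Qed.

End Limits.

(** * M-adhesive categories *)

Record madhesive := MAdhesive {
  mcat :> category;
  isM : forall A B : mcat, set (hom A B);
  M_mono : forall (A B : mcat) (f : hom A B), isM f -> is_mono f;
  M_iso : forall (A B : mcat) (f : hom A B), is_iso f -> isM f;
  M_comp : forall (A B D : mcat) (g : hom B D) (f : hom A B),
    isM g -> isM f -> isM (g \c f);
  M_decomp : forall (A B D : mcat) (g : hom B D) (f : hom A B),
    isM (g \c f) -> isM g -> isM f;
  M_pushout : forall (A B D : mcat) (f : hom A B) (g : hom A D), isM f ->
    exists (E : mcat) (f' : hom B E) (g' : hom D E), is_pushout f g f' g';
  M_pushout_closed : forall (A B D E : mcat) (f : hom A B) (g : hom A D)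
    (f' : hom B E) (g' : hom D E), is_pushout f g f' g' -> isM f -> isM g';
  M_pullback : forall (B D E : mcat) (f' : hom B E) (g' : hom D E), isM g' ->
    exists (A : mcat) (f : hom A B) (g : hom A D), is_pullback f g f' g';
  M_pullback_closed : forall (A B D E : mcat) (f : hom A B) (g : hom A D)
    (f' : hom B E) (g' : hom D E), is_pullback f g f' g' -> isM g' -> isM f;
  M_VK : forall (A B D E : mcat) (f : hom A B) (g : hom A D)
    (f' : hom B E) (g' : hom D E),
    isM f -> is_pushout f g f' g' -> is_VK isM f g f' g'
}.

Definition unique_pair_factorization (C : madhesive)
    (E' : forall A1 A2 B : C, hom A1 B -> hom A2 B -> Prop) : Prop :=
  forall (A1 A2 B : C) (f1 : hom A1 B) (f2 : hom A2 B),
  (exists (K : C) (e1 : hom A1 K) (e2 : hom A2 K) (m : hom K B),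
     [/\ E' _ _ _ e1 e2, isM m, m \c e1 = f1 & m \c e2 = f2]) /\
  (forall (K K' : C) (e1 : hom A1 K) (e2 : hom A2 K) (m : hom K B)
          (e1' : hom A1 K') (e2' : hom A2 K') (m' : hom K' B),
     [/\ E' _ _ _ e1 e2, isM m, m \c e1 = f1 & m \c e2 = f2] ->
     [/\ E' _ _ _ e1' e2', isM m', m' \c e1' = f1 & m' \c e2' = f2] ->
     exists i : hom K K',
       [/\ is_iso i, i \c e1 = e1', i \c e2 = e2' & m' \c i = m]).

(** * Nested application conditions *)

Inductive ac (C : category) : C -> Type :=
| ac_ex (P D : C) (a : hom P D) (c : ac D) : ac P
| ac_neg (P : C) (c : ac P) : ac P
| ac_and (P : C) (n : nat) (c : 'I_n -> ac P) : ac P.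

Section Conditions.
Variable C : madhesive.

Fixpoint sat (P : C) (c : ac P) : forall G : C, hom P G -> Prop :=
  match c in ac P return forall G : C, hom P G -> Prop with
  | ac_ex P D a c' => fun G p =>
      exists q : hom D G, [/\ isM q, q \c a = p & sat c' q]
  | ac_neg P c' => fun G p => ~ sat c' p
  | ac_and P n cs => fun G p => forall i : 'I_n, sat (cs i) p
  end.

Definition ac_true (P : C) : ac P :=
  ac_and (fun i : 'I_0 => match notF (ltn_ord i) with end).
Definition ac_false (P : C) : ac P := ac_neg (ac_true P).
Definition ac_and2 (P : C) (c d : ac P) : ac P :=
  ac_and (fun i : 'I_2 => if i == ord0 then c else d).
Definition ac_or (P : C) (n : nat) (c : 'I_n -> ac P) : ac P :=
  ac_neg (ac_and (fun i => ac_neg (c i))).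

Definition ac_equiv (P : C) (c d : ac P) : Prop :=
  forall (G : C) (p : hom P G), sat c p <-> sat d p.

(** * Rules and double pushout transformations *)

Record prule := PRule {
  lhs : C;
  itf : C;
  rhs : C;
  rl : hom itf lhs;
  rr : hom itf rhs;
  rlM : isM rl;
  rrM : isM rr
}.

Record rule := Rule { plain :> prule; rac : ac (lhs plain) }.

Record dpo (p : prule) (G : C) (m : hom (lhs p) G) := DPO {
  ctx : C;
  res : C;
  ctx_in : hom (itf p) ctx;
  ctx_l : hom ctx G;
  ctx_r : hom ctx res;
  comatch : hom (rhs p) res;
  dpo_left : is_pushout (rl p) ctx_in m ctx_l;
  dpo_right : is_pushout (rr p) ctx_in comatch ctx_r
}.

Definition dpo_span (p : prule) (G : C) (m : hom (lhs p) G) (t : dpo m) :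
    prule :=
  PRule (M_pushout_closed (dpo_left t) (rlM p))
        (M_pushout_closed (dpo_right t) (rrM p)).

(* Shift and Left are not unique as syntax: any operators satisfying their
   defining semantic properties are allowed. *)
Record ac_transport := ACTransport {
  ac_shift : forall P P' : C, hom P P' -> ac P -> ac P';
  ac_shiftP : forall (P P' : C) (b : hom P P') (c : ac P)
    (G : C) (n : hom P' G), sat (ac_shift b c) n <-> sat c (n \c b);
  ac_left : forall p : prule, ac (rhs p) -> ac (lhs p);
  ac_leftP : forall (p : prule) (c : ac (rhs p)) (G : C) (m : hom (lhs p) G)
    (t : dpo m), sat (ac_left c) m <-> sat c (comatch t)
}.

Record tpair (p1 p2 : prule) := TPair {
  src : C;
  mt1 : hom (lhs p1) src;
  mt2 : hom (lhs p2) src;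
  tr1 : dpo mt1;
  tr2 : dpo mt2
}.

Section Embeddings.
Variables p1 p2 : prule.

Definition plain_parallel_independent (t : tpair p1 p2) : Prop :=
  (exists d12 : hom (lhs p1) (ctx (tr2 t)), ctx_l (tr2 t) \c d12 = mt1 t) /\
  (exists d21 : hom (lhs p2) (ctx (tr1 t)), ctx_l (tr1 t) \c d21 = mt2 t).

Definition plain_conflict (t : tpair p1 p2) : Prop :=
  ~ plain_parallel_independent t.

(* Extension diagram over [e], with vertical morphisms [e], [eD], [eH]. *)
Definition extension_diagram (p : prule) (K G : C)
    (o : hom (lhs p) K) (m : hom (lhs p) G) (t : dpo o) (t' : dpo m)
    (e : hom K G) (eD : hom (ctx t) (ctx t')) (eH : hom (res t) (res t')) :
    Prop :=
  [/\ e \c o = m,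
      eD \c ctx_in t = ctx_in t',
      eH \c comatch t = comatch t',
      is_pushout (ctx_l t) eD e (ctx_l t') &
      is_pushout (ctx_r t) eD eH (ctx_r t')].

Definition embeds (t t' : tpair p1 p2) (e : hom (src t) (src t')) : Prop :=
  (exists eD eH, extension_diagram (t := tr1 t) (t' := tr1 t') e eD eH) /\
  (exists eD eH, extension_diagram (t := tr2 t) (t' := tr2 t') e eD eH).

Definition tpair_iso (t t' : tpair p1 p2) : Prop :=
  exists e : hom (src t) (src t'), [/\ is_iso e,
    exists eD eH, [/\ is_iso eD, is_iso eH &
      extension_diagram (t := tr1 t) (t' := tr1 t') e eD eH] &
    exists eD eH, [/\ is_iso eD, is_iso eH &
      extension_diagram (t := tr2 t) (t' := tr2 t') e eD eH]].

Definition is_initial_pair (tI t : tpair p1 p2) : Prop :=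
  exists fI : hom (src tI) (src t), embeds fI /\
  forall (t' : tpair p1 p2) (f : hom (src t') (src t)), embeds f ->
    exists! f' : hom (src tI) (src t'), embeds f' /\ f \c f' = fI.

Definition plain_initial_conflict (t : tpair p1 p2) : Prop :=
  plain_conflict t /\ exists tI, is_initial_pair tI t /\ tpair_iso t tI.

(* R1 + L2 <= L1 + L2 => L1 + R2, with contexts I1 + L2 and L1 + I2. *)
Definition coproduct_tpair (cp : binary_coproducts C) : tpair p1 p2 :=
  TPair
    (DPO (pushout_inl cp (lhs p2) (rl p1)) (pushout_inl cp (lhs p2) (rr p1)))
    (DPO (pushout_inr cp (lhs p1) (rl p2)) (pushout_inr cp (lhs p1) (rr p2))).

End Embeddings.

Definition has_initial_pairs_for_conflicts (sys : set rule) : Prop :=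
  forall r1 r2 : rule, sys r1 -> sys r2 ->
  forall t : tpair r1 r2, plain_conflict t -> exists tI, is_initial_pair tI t.

(** * Transformation pairs via rules with application conditions *)

Section RulePair.
Variables (T : ac_transport) (r1 r2 : rule).

(* An element of [tpair r1 r2] is a pair of AC-disregarding transformations;
   it is a pair of direct transformations when both matches satisfy the
   application conditions. *)
Definition direct (t : tpair r1 r2) : Prop :=
  sat (rac r1) (mt1 t) /\ sat (rac r2) (mt2 t).

Definition parallel_independent (t : tpair r1 r2) : Prop :=
  (exists d12 : hom (lhs r1) (ctx (tr2 t)),
     ctx_l (tr2 t) \c d12 = mt1 t /\ sat (rac r1) (ctx_r (tr2 t) \c d12)) /\
  (exists d21 : hom (lhs r2) (ctx (tr1 t)),
     ctx_l (tr1 t) \c d21 = mt2 t /\ sat (rac r2) (ctx_r (tr1 t) \c d21)).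

Definition parallel_dependent (t : tpair r1 r2) : Prop :=
  ~ parallel_independent t.

Definition Mcomplete (U : set (tpair r1 r2)) : Prop :=
  forall t : tpair r1 r2, direct t -> parallel_dependent t ->
  exists t' : tpair r1 r2, U t' /\
    exists e : hom (src t') (src t), isM e /\ embeds e.

Definition acK (t : tpair r1 r2) : ac (src t) :=
  ac_and2 (ac_shift T (mt1 t) (rac r1)) (ac_shift T (mt2 t) (rac r2)).

(* The morphism [d] is unique if it exists, since [ctx_l t] is monic. *)
Definition acS_half (r : rule) (q : prule) (K : C)
    (o : hom (lhs r) K) (o' : hom (lhs q) K) (t : dpo o') : ac K :=
  match pselect (exists d : hom (lhs r) (ctx t), ctx_l t \c d = o) with
  | left ex =>
      ac_left T (p := dpo_span t) (ac_shift T (ctx_r t \c sval (cid ex)) (rac r))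
  | right _ => ac_false K
  end.

Definition acS (t : tpair r1 r2) : ac (src t) :=
  ac_neg (ac_and2 (acS_half (r := r1) (mt1 t) (tr2 t))
                  (acS_half (r := r2) (mt2 t) (tr1 t))).

Record stp := STP {
  stp_pair :> tpair r1 r2;
  stp_ac : ac (src stp_pair);
  stp_acS : ac (src stp_pair);
  stp_acE : stp_ac = acK stp_pair;
  stp_acSE : stp_acS = acS stp_pair
}.

Definition unfolding (s : stp) : set (tpair r1 r2) :=
  [set t | direct t /\ exists e : hom (src s) (src t), embeds e].

Definition conflict_inducing (s : stp) : Prop :=
  exists t, unfolding s t /\ parallel_dependent t.

Definition initial_conflict (cp : binary_coproducts C) (s : stp) : Prop :=
  conflict_inducing s /\
  (plain_initial_conflict s \/ tpair_iso s (coproduct_tpair r1 r2 cp)).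

(* The initial conflicts, as usual only determined up to isomorphism: [S] may
   be the class of all of them or any subclass meeting every isomorphism
   class (isomorphic pairs have equivalent application conditions). *)
Definition is_set_of_initial_conflicts (cp : binary_coproducts C)
    (S : set stp) : Prop :=
  S `<=` initial_conflict cp /\
  forall s, initial_conflict cp s -> exists s', S s' /\ tpair_iso s s'.

(* Data of the condition  \/_(i < n) exists (a_i, /\_(j < m_i) ~ exists
   (b_ij, d_ij))  with n > 0 and no b_ij an isomorphism. *)
Record disjunctive_form (K : C) := DisjunctiveForm {
  df_n : nat;
  df_n_gt0 : 0 < df_n;
  df_obj : 'I_df_n -> C;
  df_a : forall i, hom K (df_obj i);
  df_m : 'I_df_n -> nat;
  df_tgt : forall i, 'I_(df_m i) -> C;
  df_b : forall i (j : 'I_(df_m i)), hom (df_obj i) (df_tgt j);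
  df_d : forall i (j : 'I_(df_m i)), ac (df_tgt j);
  df_b_noniso : forall i (j : 'I_(df_m i)), ~ is_iso (df_b j)
}.

Definition df_ac (K : C) (F : disjunctive_form K) : ac K :=
  ac_or (fun i : 'I_(df_n F) => ac_ex (df_a i)
    (ac_and (fun j : 'I_(df_m i) => ac_neg (ac_ex (df_b j) (df_d j))))).

Definition represents (s : stp) (F : disjunctive_form (src s)) : Prop :=
  ac_equiv (ac_and2 (stp_ac s) (stp_acS s)) (df_ac F).

Definition regular (s : stp) : Prop :=
  exists F : disjunctive_form (src s), represents F.

(* The pairs of direct transformations from C_i with matches a_i o_1 and
   a_i o_2; each such pair is determined up to isomorphism by i. *)
Definition disjunctive_unfolding (s : stp) (F : disjunctive_form (src s)) :
    set (tpair r1 r2) :=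
  [set t | direct t /\
     exists (i : 'I_(df_n F)) (t1 : dpo (df_a i \c mt1 s))
            (t2 : dpo (df_a i \c mt2 s)), t = TPair t1 t2].

Definition finite_up_to_iso (U : set (tpair r1 r2)) : Prop :=
  exists V : set (tpair r1 r2), [/\ finite_set V, V `<=` U &
    forall t, U t -> exists t', V t' /\ tpair_iso t t'].

End RulePair.

End Conditions.

(* Main.v *)
Require Import Defs.
From mathcomp Require Import all_boot.
From mathcomp Require Import boolp classical_sets functions cardinality.
Set Implicit Arguments.
Unset Strict Implicit.
Unset Printing Implicit Defensive.
Local Open Scope classical_set_scope.

(* [compA] is also the name of an ssrfun lemma. *)
Local Notation compA := Defs.compA.

(* Let t be a parallel dependent pair of direct transformations.  If t is a
   plain conflict, its initial pair is an initial conflict embedding into t;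
   otherwise the coproduct pair embeds into t.  So some s in S embeds into t
   via some e, and e satisfies ac_K and ac*_K because t is direct and
   dependent.  The disjunctive form then yields an M-morphism q out of some C_i
   with q a_i = e, and both transformations restrict along q by the van Kampen
   property.  The restricted pair is direct because the identity of C_i
   satisfies c_i (no b_j is an isomorphism, hence no b_j has a left inverse in
   M), so that a_i satisfies ac_K.  Finiteness up to isomorphism is the
   uniqueness of pushout complements along M. *)

(** * Pushouts and pullbacks in an arbitrary category *)

Section CategoryTheory.
Variable C : category.

Lemma is_iso_idm (A : C) : is_iso (idm A).
Proof. by exists (idm A); rewrite comp1m. Qed.

Lemma is_pushout_sym (A B D E : C) (f : hom A B) (g : hom A D)
    (f' : hom B E) (g' : hom D E) :
  is_pushout f g f' g' -> is_pushout g f g' f'.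
Proof.
move=> [eq_sq po]; split=> // X u v /esym/po[w [[wl wr] w_uniq]].
by exists w; split=> // w' [? ?]; apply: w_uniq.
Qed.

Lemma is_pushout_idm (A D : C) (g : hom A D) :
  is_pushout (idm A) g g (idm D).
Proof.
split; first by rewrite comp1m compm1.
move=> X u v; rewrite compm1 => u_eq; exists v.
by split=> [|w' [_ <-]]; rewrite compm1.
Qed.

(** The outer pushout induces the mediating morphism; the inner one shows that it also agrees with
    [u]. *)
Lemma is_pushout_decomp (A B D E D2 E2 : C) (f : hom A B) (g : hom A D)
    (f' : hom B E) (g' : hom D E) (h : hom D D2) (h' : hom E E2)
    (k : hom D2 E2) :
  is_pushout f g f' g' -> is_pushout f (h \c g) (h' \c f') k ->
  h' \c g' = k \c h -> is_pushout g' h h' k.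
Proof.
move=> [eq1 po1] [eq2 po2] eq_sq; split=> // X u v uv.
have [|w [[wl wr] w_uniq]] := po2 X (u \c f') v.
  by rewrite -compA eq1 !compA uv.
have uv' : (u \c f') \c f = (u \c g') \c g by rewrite -!compA eq1.
have [z [_ z_uniq]] := po1 X _ _ uv'.
exists w; split.
  split=> //; rewrite -(z_uniq u) //; apply/esym/z_uniq; split.
    by rewrite -compA.
  by rewrite -compA eq_sq compA wr uv.
by move=> w' [wu' wv']; apply: w_uniq; rewrite compA wu'.
Qed.

(** The inverse of [f'] is induced by [idm B] and [f \c gi]. *)
Lemma is_pushout_iso (A B D E : C) (f : hom A B) (g : hom A D)
    (f' : hom B E) (g' : hom D E) :
  is_pushout f g f' g' -> is_iso g -> is_iso f'.
Proof.
move=> [eq_sq po] [gi [gig ggi]].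
have [|w [[wl wr] _]] := po B (idm B) (f \c gi).
  by rewrite comp1m -compA gig compm1.
exists w; split=> //.
have eq_f : f' \c f = (g' \c idm D) \c g by rewrite compm1.
have [z [_ z_uniq]] := po E f' (g' \c idm D) eq_f.
(* Both [f' \c w] and the identity of [E] mediate the cocone given by [f'] and [g']. *)
rewrite -(z_uniq (f' \c w)); last first.
  rewrite -!compA wl wr; split; first by rewrite compm1.
  by rewrite !compA eq_sq -!compA ggi.
by apply: z_uniq; rewrite !comp1m compm1.
Qed.

Lemma is_pullback_idm (A B : C) (f : hom A B) :
  is_pullback (idm A) f f (idm B).
Proof.
split; first by rewrite comp1m compm1.
move=> X u v; rewrite comp1m => uv; exists u.
by split=> [|w' [<- _]]; rewrite comp1m.
Qed.

(** Supplies back and front faces of the van Kampen cubes below. *)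
Lemma is_pullback_mono (X A E : C) (d : hom A E) (t : hom X A) :
  is_mono d -> is_pullback (idm X) t (d \c t) d.
Proof.
move=> d_mono; split; first by rewrite compm1.
move=> Y u v uv; exists u; split.
  by rewrite comp1m; split=> //; apply: d_mono; rewrite compA.
by move=> w' [<- _]; rewrite comp1m.
Qed.

Lemma is_pullback_sym (A B D E : C) (f : hom A B) (g : hom A D)
    (f' : hom B E) (g' : hom D E) :
  is_pullback f g f' g' -> is_pullback g f g' f'.
Proof.
move=> [eq_sq pb]; split=> // X u v /esym/pb[w [[wl wr] w_uniq]].
by exists w; split=> // w' [? ?]; apply: w_uniq.
Qed.

Lemma mono_left_inverse_iso (A B : C) (b : hom A B) (q : hom B A) :
  is_mono q -> q \c b = idm A -> is_iso b.
Proof.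
move=> q_mono qb; exists q; split=> //; apply: q_mono.
by rewrite compA qb comp1m compm1.
Qed.

End CategoryTheory.

(** * Pushouts along M-morphisms *)

Section Transformations.
Variable C : madhesive.

Lemma isM_idm (A : C) : isM (idm A).
Proof. exact/M_iso/is_iso_idm. Qed.

(* [M_VK] with the data of the cube as implicit arguments. *)
Lemma van_Kampen (A B D E A' B' D' E' : C) (f : hom A B) (g : hom A D)
    (f' : hom B E) (g' : hom D E) (tf : hom A' B') (tg : hom A' D')
    (tf' : hom B' E') (tg' : hom D' E') (a : hom A' A) (b : hom B' B)
    (d : hom D' D) (e : hom E' E) :
  isM f -> is_pushout f g f' g' -> isM b -> isM d -> isM e ->
  tf' \c tf = tg' \c tg -> f' \c b = e \c tf' -> g' \c d = e \c tg' ->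
  is_pullback a tf f b -> is_pullback a tg g d ->
  is_pushout tf tg tf' tg' <->
  is_pullback b tf' f' e /\ is_pullback d tg' g' e.
Proof. by move=> fM po; apply: M_VK. Qed.

Lemma is_pushout_isM_is_pullback (A B D E : C) (f : hom A B) (g : hom A D)
    (f' : hom B E) (g' : hom D E) :
  isM f -> is_pushout f g f' g' -> is_pullback f g f' g'.
Proof.
move=> fM po; have f_mono := M_mono fM.
have pbf : is_pullback (idm A) (idm A) f f.
  by have := is_pullback_mono (idm A) f_mono; rewrite compm1.
(* The cube has the trivial pushout of [idm A] along [g] as top and vertical morphisms [idm A], [f],
   [idm D], [g']; one front face is the given square. *)
have [vk _] : is_pushout (idm A) g g (idm D) <->
    is_pullback f g f' g' /\ is_pullback (idm D) (idm D) g' g'.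
  apply: (van_Kampen fM po fM (isM_idm D) (M_pushout_closed po fM) _ po.1 _
    pbf (is_pullback_idm g)) => //.
  exact: (is_pushout_idm g).1.
by case: (vk (is_pushout_idm g)).
Qed.

(** * Extension, restriction and uniqueness of double pushouts *)

Section Dpo.
Variable p : prule C.

Lemma ctx_lM (G : C) (m : hom (lhs p) G) (t : dpo m) : isM (ctx_l t).
Proof. exact: M_pushout_closed (dpo_left t) (rlM p). Qed.

(** A commuting context square suffices: [ctx_l t'] is monic, so [eD] respects [ctx_in]; the right
    pushout then induces [eH], and pushout decomposition yields both squares. *)
Lemma extension_diagramI (K G : C) (o : hom (lhs p) K) (m : hom (lhs p) G)
    (t : dpo o) (t' : dpo m) (e : hom K G) (eD : hom (ctx t) (ctx t')) :
  e \c o = m -> e \c ctx_l t = ctx_l t' \c eD ->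
  exists eH, extension_diagram (t := t) (t' := t') e eD eH.
Proof.
move=> eo eD_l.
have eD_in : eD \c ctx_in t = ctx_in t'.
  apply: (M_mono (ctx_lM t')).
  by rewrite compA -eD_l -compA -(dpo_left t).1 compA eo (dpo_left t').1.
have [|eH [[eH_co eH_r] _]] :=
    (dpo_right t).2 _ (comatch t') (ctx_r t' \c eD).
  by rewrite -compA eD_in (dpo_right t').1.
exists eH; split=> //.
  apply: is_pushout_decomp (dpo_left t) _ eD_l.
  by rewrite eD_in eo; apply: dpo_left.
apply: is_pushout_decomp (dpo_right t) _ eH_r.
by rewrite eD_in eH_co; apply: dpo_right.
Qed.

Lemma dpo_restrict (K G : C) (o : hom (lhs p) K) (m : hom (lhs p) G)
    (q : hom K G) (t : dpo m) :
  isM q -> q \c o = m ->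
  exists (t' : dpo o) (eD : hom (ctx t') (ctx t)),
    q \c ctx_l t' = ctx_l t \c eD.
Proof.
move=> qM qo.
have [D [d [k pb]]] := M_pullback (ctx_l t) qM.
have dM := M_pullback_closed pb qM.
(* The pullback [D] is the restricted context, and [g] becomes its [ctx_in]. *)
have [|g [[dg kg] _]] := pb.2 _ (ctx_in t) (o \c rl p).
  by rewrite compA qo (dpo_left t).1.
have pb_in : is_pullback (idm _) g (ctx_in t) d.
  by rewrite -dg; apply: is_pullback_mono; apply: M_mono.
have pb_o : is_pullback (idm _) o m q.
  by rewrite -qo; apply: is_pullback_mono; apply: M_mono.
(* Cube over the left pushout of [t] with vertical morphisms [idm], [idm], [d], [q]. *)
have [_ po] : is_pushout (rl p) g o k <->
    is_pullback (idm _) o m q /\ is_pullback d k (ctx_l t) q.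
  apply: (van_Kampen (rlM p) (dpo_left t) (isM_idm _) dM qM (esym kg) _ pb.1
    (is_pullback_idm (rl p)) pb_in).
  by rewrite compm1.
have [H [co [r po_r]]] := M_pushout g (rrM p).
by exists (DPO (po (conj pb_o pb)) po_r), d; rewrite pb.1.
Qed.

(** In the cube over the left pushout of [t] whose front faces are the left square of [t'] and [pb],
    the top exhibits [d'] as a pushout of an identity. *)
Lemma ctx_pullback_iso (G : C) (m : hom (lhs p) G) (t t' : dpo m) (P : C)
    (d : hom P (ctx t)) (d' : hom P (ctx t')) :
  is_pullback d d' (ctx_l t) (ctx_l t') -> is_iso d'.
Proof.
move=> pb.
have dM := M_pullback_closed pb (ctx_lM t').
have [|g [[dg d'g] _]] := pb.2 _ (ctx_in t) (ctx_in t').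
  by rewrite -(dpo_left t).1 -(dpo_left t').1.
have pb_in : is_pullback (idm _) g (ctx_in t) d.
  by rewrite -dg; apply: is_pullback_mono; apply: M_mono.
have pb_l : is_pullback (idm _) (idm _) (rl p) (rl p).
  have := is_pullback_mono (idm _) (M_mono (rlM p)).
  by rewrite compm1.
have pb' := is_pushout_isM_is_pullback (rlM p) (dpo_left t').
have [_ po] : is_pushout (idm _) g (ctx_in t') d' <->
    is_pullback (rl p) (ctx_in t') m (ctx_l t') /\
    is_pullback d d' (ctx_l t) (ctx_l t').
  apply: (van_Kampen (rlM p) (dpo_left t) (rlM p) dM (ctx_lM t') _ pb'.1 pb.1
    pb_l pb_in).
  by rewrite compm1 d'g.
exact: is_pushout_iso (is_pushout_sym (po (conj pb' pb))) (is_iso_idm _).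
Qed.

Lemma ctx_unique (G : C) (m : hom (lhs p) G) (t t' : dpo m) :
  exists eD : hom (ctx t) (ctx t'), is_iso eD /\ ctx_l t = ctx_l t' \c eD.
Proof.
have [P [d [d' pb]]] := M_pullback (ctx_l t) (ctx_lM t').
have [di [did ddi]] := ctx_pullback_iso (is_pullback_sym pb).
have [d'i [d'id dd'i]] := ctx_pullback_iso pb.
exists (d' \c di); split.
  exists (d \c d'i); split.
    by rewrite -compA (compA d'i) d'id comp1m.
  by rewrite -compA (compA di) did comp1m.
by rewrite compA -pb.1 -compA ddi compm1.
Qed.

Lemma extension_diagram_iso (K G : C) (o : hom (lhs p) K) (m : hom (lhs p) G)
    (t : dpo o) (t' : dpo m) (e : hom K G) (eD : hom (ctx t) (ctx t')) :
  e \c o = m -> e \c ctx_l t = ctx_l t' \c eD -> is_iso eD ->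
  exists eD eH, [/\ is_iso eD, is_iso eH &
    extension_diagram (t := t) (t' := t') e eD eH].
Proof.
move=> eo eD_l eD_iso; have [eH ext] := extension_diagramI eo eD_l.
exists eD, eH; split=> //.
by case: ext => _ _ _ _ po; apply: is_pushout_iso po eD_iso.
Qed.

End Dpo.

(** * Embeddings, initial pairs and the coproduct pair *)

Section Pairs.
Variables p1 p2 : prule C.
Implicit Types t : tpair p1 p2.

(** By [extension_diagramI], the result part of an embedding comes for free. *)
Lemma embedsE t t' (e : hom (src t) (src t')) :
  embeds e <->
  (e \c mt1 t = mt1 t' /\
     exists eD, e \c ctx_l (tr1 t) = ctx_l (tr1 t') \c eD) /\
  (e \c mt2 t = mt2 t' /\
     exists eD, e \c ctx_l (tr2 t) = ctx_l (tr2 t') \c eD).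
Proof.
split=> [[[eD1 [eH1 [e1 _ _ po1 _]]] [eD2 [eH2 [e2 _ _ po2 _]]]]|].
  by split; split=> //; [exists eD1; case: po1|exists eD2; case: po2].
move=> [[e1 [eD1 l1]] [e2 [eD2 l2]]]; split.
  by exists eD1; apply: extension_diagramI.
by exists eD2; apply: extension_diagramI.
Qed.

Lemma embeds_id t : embeds (idm (src t) : hom (src t) (src t)).
Proof.
by apply/embedsE; rewrite !comp1m; do 2!split=> //; exists (idm _);
  rewrite compm1.
Qed.

Lemma embeds_comp t t' t'' (e : hom (src t) (src t'))
    (e' : hom (src t') (src t'')) :
  embeds e -> embeds e' -> embeds (e' \c e).
Proof.
move=> /embedsE[[e1 [eD1 l1]] [e2 [eD2 l2]]].
move=> /embedsE[[e1' [eD1' l1']] [e2' [eD2' l2']]].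
apply/embedsE; split; split.
- by rewrite -compA e1.
- by exists (eD1' \c eD1); rewrite -compA l1 !compA l1'.
- by rewrite -compA e2.
- by exists (eD2' \c eD2); rewrite -compA l2 !compA l2'.
Qed.

Lemma extension_diagram_inv (p : prule C) (K G : C) (o : hom (lhs p) K)
    (m : hom (lhs p) G) (t : dpo o) (t' : dpo m) (e : hom K G) (e' : hom G K)
    (eD : hom (ctx t) (ctx t')) (eH : hom (res t) (res t')) :
  e' \c e = idm K -> is_iso eD ->
  extension_diagram (t := t) (t' := t') e eD eH ->
  e' \c m = o /\ exists eD', e' \c ctx_l t' = ctx_l t \c eD'.
Proof.
move=> e'e [eD' [_ eDK]] [eo _ _ [eD_l _] _].
split; first by rewrite -eo compA e'e comp1m.
exists eD'; rewrite -[LHS]compm1 -eDK.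
by rewrite -!compA (compA _ eD) -eD_l !compA e'e comp1m.
Qed.

Lemma tpair_iso_embeds_inv t t' :
  tpair_iso t t' -> exists e : hom (src t') (src t), embeds e.
Proof.
move=> [e [[e' [e'e _]] [eD1 [eH1 [iso1 _ ext1]]] [eD2 [eH2 [iso2 _ ext2]]]]].
exists e'; apply/embedsE; split.
  exact: extension_diagram_inv e'e iso1 ext1.
exact: extension_diagram_inv e'e iso2 ext2.
Qed.

Lemma tpair_unique (K : C) (m1 : hom (lhs p1) K) (m2 : hom (lhs p2) K)
    (t1 t1' : dpo m1) (t2 t2' : dpo m2) :
  tpair_iso (TPair t1 t2) (TPair t1' t2').
Proof.
exists (idm K); split; first exact: is_iso_idm.
  have [eD [eD_iso eD_l]] := ctx_unique t1 t1'.
  by apply: (extension_diagram_iso _ _ eD_iso); rewrite comp1m.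
have [eD [eD_iso eD_l]] := ctx_unique t2 t2'.
by apply: (extension_diagram_iso _ _ eD_iso); rewrite comp1m.
Qed.

Lemma tpair_iso_refl t : tpair_iso t t.
Proof. by case: t => K m1 m2 t1 t2; apply: tpair_unique. Qed.

(** Independence is carried along [e] by composing [d12] and [d21] with the context morphisms. *)
Lemma plain_conflict_embeds t t' (e : hom (src t) (src t')) :
  embeds e -> plain_conflict t' -> plain_conflict t.
Proof.
move=> /embedsE[[e1 [eD1 l1]] [e2 [eD2 l2]]]; apply: contra_not.
move=> [[d12 d12E] [d21 d21E]]; split.
  by exists (eD2 \c d12); rewrite compA -l2 -compA d12E.
by exists (eD1 \c d21); rewrite compA -l1 -compA d21E.
Qed.

(* If f' factors fI through f : t' -> tI, then f f' and the identity are both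
   factorizations of fI through fI, hence equal. *)
Lemma is_initial_pair_self tI t : is_initial_pair tI t -> is_initial_pair tI tI.
Proof.
move=> [fI [fI_emb init]]; exists (idm _); split; first exact: embeds_id.
move=> t' f f_emb.
have [f' [[f'_emb f'E] f'_uniq]] := init t' _ (embeds_comp f_emb fI_emb).
have [z [_ z_uniq]] := init tI fI fI_emb.
exists f'; split; last first.
  by move=> w [w_emb wE]; apply: f'_uniq; rewrite -compA wE compm1.
split=> //; rewrite -(z_uniq (f \c f')).
  by apply: z_uniq; rewrite compm1; split=> //; apply: embeds_id.
by split; [apply: embeds_comp|rewrite compA].
Qed.

Lemma plain_conflict_initial t :
  plain_conflict t -> (exists tI, is_initial_pair tI t) ->
  exists s, plain_initial_conflict s /\
    exists e : hom (src s) (src t), embeds e.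
Proof.
move=> t_conf [tI tI_init]; have [fI [fI_emb _]] := tI_init.
exists tI; split; last by exists fI.
split; first exact: plain_conflict_embeds fI_emb t_conf.
exists tI; split; first exact: is_initial_pair_self tI_init.
exact: tpair_iso_refl.
Qed.

Lemma coproduct_tpair_embeds (cp : binary_coproducts C) t :
  plain_parallel_independent t ->
  exists e : hom (src (coproduct_tpair p1 p2 cp)) (src t), embeds e.
Proof.
move=> [[d12 d12E] [d21 d21E]]; exists (copair cp (mt1 t) (mt2 t)).
apply/embedsE; rewrite /= copair_inl copair_inr; split; split=> //.
(* The contexts of the coproduct pair are I1 + L2 and L1 + I2, so [d21] and [d12] provide the
   components on L2 and L1. *)
- exists (copair cp (ctx_in (tr1 t)) d21); apply: copair_ext.
    rewrite -!compA /coprod_map !copair_inl compA copair_inl.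
    exact: (dpo_left (tr1 t)).1.
  by rewrite -!compA /coprod_map !copair_inr compm1 copair_inr d21E.
- exists (copair cp d12 (ctx_in (tr2 t))); apply: copair_ext.
    by rewrite -!compA /coprod_map !copair_inl compm1 copair_inl d12E.
  rewrite -!compA /coprod_map !copair_inr compA copair_inr.
  exact: (dpo_left (tr2 t)).1.
Qed.

End Pairs.

(** * Satisfaction of derived conditions *)

Lemma sat_and2 (P G : C) (c d : ac P) (p : hom P G) :
  sat (ac_and2 c d) p <-> sat c p /\ sat d p.
Proof.
split=> [cd|[cp dp] i /=]; last by case: ifP.
by split; [exact: (cd ord0)|exact: (cd (lift ord0 ord0))].
Qed.

Lemma sat_or (P G : C) (n : nat) (c : 'I_n -> ac P) (p : hom P G) :
  sat (ac_or c) p <-> exists i, sat (c i) p.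
Proof.
split=> /= [|[i ci] nc]; last exact: (nc i).
by move=> /existsNP[i /contrapT ci]; exists i.
Qed.

Lemma df_ac_df_a (K : C) (F : disjunctive_form K) (i : 'I_(df_n F)) :
  sat (df_ac F) (df_a i).
Proof.
apply/sat_or; exists i, (idm _); split; first exact: isM_idm.
  by rewrite comp1m.
(* A morphism [q] violating a negated conjunct would be a monic left inverse of [df_b j]. *)
move=> j [q [qM qb _]].
exact: (@df_b_noniso _ _ F i j (mono_left_inverse_iso (M_mono qM) qb)).
Qed.

(** * Symbolic transformation pairs and their disjunctive unfoldings *)

Section SymbolicPairs.
Variables (T : ac_transport C) (r1 r2 : rule C).
Implicit Types t : tpair r1 r2.

Lemma sat_acK t (G : C) (e : hom (src t) G) :
  sat (acK T t) e <->
  sat (rac r1) (e \c mt1 t) /\ sat (rac r2) (e \c mt2 t).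
Proof. by rewrite sat_and2 !ac_shiftP. Qed.

(* An extension diagram over [e] is a transformation via the derived span with
   match [e] and comatch [eH]. *)
Lemma sat_acS_half (r : rule C) (q : prule C) (K G : C) (o : hom (lhs r) K)
    (o' : hom (lhs q) K) (m' : hom (lhs q) G) (t : dpo o') (t' : dpo m')
    (e : hom K G) eD eH :
  extension_diagram (t := t) (t' := t') e eD eH ->
  sat (acS_half T (r := r) o t) e ->
  exists d : hom (lhs r) (ctx t'),
    ctx_l t' \c d = e \c o /\ sat (rac r) (ctx_r t' \c d).
Proof.
move=> [_ _ _ po_l po_r]; rewrite /acS_half.
case: pselect => [ex|_]; last first.
  by move=> /= nt; case: nt => -[].
pose u : dpo (p := dpo_span t) e :=
  @DPO _ (dpo_span t) _ e _ _ _ _ _ _ po_l po_r.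
move/(ac_leftP T _ u)/ac_shiftP => /=; case: (cid ex) => d /= dE.
rewrite compA po_r.1 => sat_d; exists (eD \c d); split; last by rewrite compA.
by rewrite compA -po_l.1 -compA dE.
Qed.

Lemma sat_acS t t' (e : hom (src t) (src t')) :
  embeds e -> parallel_dependent t' -> sat (acS T t) e.
Proof.
move=> [[eD1 [eH1 ext1]] [eD2 [eH2 ext2]]] dep /sat_and2[half1 half2].
apply: dep; split.
  have [d [dl dsat]] := sat_acS_half ext2 half1.
  by exists d; split=> //; rewrite dl; case: ext1.
have [d [dl dsat]] := sat_acS_half ext1 half2.
by exists d; split=> //; rewrite dl; case: ext2.
Qed.

Lemma initial_conflict_embeds (cp : binary_coproducts C) t :
  (plain_conflict t -> exists tI, is_initial_pair tI t) ->
  direct t -> parallel_dependent t ->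
  exists s : stp T r1 r2, initial_conflict cp s /\
    exists e : hom (src s) (src t), embeds e.
Proof.
move=> has_init t_dir t_dep.
have [s [s_init s_emb]] : exists s : tpair r1 r2,
    (plain_initial_conflict s \/ tpair_iso s (coproduct_tpair r1 r2 cp)) /\
    exists e : hom (src s) (src t), embeds e.
  have [t_indep|t_conf] := pselect (plain_parallel_independent t).
    exists (coproduct_tpair r1 r2 cp).
    split; last exact: coproduct_tpair_embeds.
    by right; apply: tpair_iso_refl.
  have [s [s_init s_emb]] := plain_conflict_initial t_conf (has_init t_conf).
  by exists s; split=> //; left.
(* The pair [t] itself, a dependent member of the unfolding, makes this symbolic pair
   conflict-inducing. *)
exists (STP (stp_pair := s) (erefl (acK T s)) (erefl (acS T s))).
by split=> //; split=> //; exists t.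
Qed.

(** The representation is used in both directions: at [e] to obtain [i] and [q], and at [df_a i] to
    see that the restricted pair is direct. *)
Lemma disjunctive_unfolding_embeds (s : stp T r1 r2)
    (F : disjunctive_form (src s)) t (e : hom (src s) (src t)) :
  represents F -> embeds e -> direct t -> parallel_dependent t ->
  exists t', disjunctive_unfolding F t' /\
    exists q : hom (src t') (src t), isM q /\ embeds q.
Proof.
move=> repF e_emb [sat1 sat2] t_dep.
have /embedsE[[e1 _] [e2 _]] := e_emb.
have /repF/sat_or[i [q [qM qa _]]] : sat (ac_and2 (stp_ac s) (stp_acS s)) e.
  rewrite stp_acE stp_acSE; apply/sat_and2; split; last exact: sat_acS t_dep.
  by apply/sat_acK; rewrite e1 e2.
have qa1 : q \c (df_a i \c mt1 s) = mt1 t by rewrite compA qa.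
have qa2 : q \c (df_a i \c mt2 s) = mt2 t by rewrite compA qa.
have [t1 [eD1 l1]] := dpo_restrict (tr1 t) qM qa1.
have [t2 [eD2 l2]] := dpo_restrict (tr2 t) qM qa2.
exists (TPair t1 t2); split; last first.
  exists q; split=> //; apply/embedsE.
  by split; split=> //; [exists eD1|exists eD2].
split; last by exists i, t1, t2.
have /repF/sat_and2[] : sat (df_ac F) (df_a i) by apply: df_ac_df_a.
by rewrite stp_acE => /sat_acK.
Qed.

(** * Finiteness up to isomorphism *)

Lemma finite_up_to_iso_subsingleton (U : set (tpair r1 r2)) :
  (forall t t', U t -> U t' -> tpair_iso t t') -> finite_up_to_iso U.
Proof.
move=> U_iso; have [[t0 Ut0]|U0] := pselect (exists t0, U t0).
  exists [set t0]; split; first exact: finite_set1.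
    by move=> _ ->.
  by move=> t Ut; exists t0; split=> //; apply: U_iso.
exists set0; split=> //.
by move=> t Ut; case: U0; exists t.
Qed.

Lemma finite_up_to_iso_bigcup (I : Type) (D : set I)
    (U : I -> set (tpair r1 r2)) :
  finite_set D -> (forall i, finite_up_to_iso (U i)) ->
  finite_up_to_iso (\bigcup_(i in D) U i).
Proof.
move=> D_fin /choice[V VP]; exists (\bigcup_(i in D) V i); split.
- by apply: bigcup_finite => // i _; case: (VP i).
- by apply: subset_bigcup => i _; case: (VP i).
- move=> t [i Di Uit]; have [_ _ /(_ t Uit)[t' [Vt' tt']]] := VP i.
  by exists t'; split=> //; exists i.
Qed.

Lemma finite_up_to_iso_disjunctive_unfolding (s : stp T r1 r2)
    (F : disjunctive_form (src s)) :
  finite_up_to_iso (disjunctive_unfolding F).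
Proof.
pose U (i : 'I_(df_n F)) := [set t : tpair r1 r2 | direct t /\
  exists (t1 : dpo (df_a i \c mt1 s)) (t2 : dpo (df_a i \c mt2 s)),
    t = TPair t1 t2].
(* Split by the finite index; by [tpair_unique], each [U i] holds at most one pair up to
   isomorphism. *)
have -> : disjunctive_unfolding F = \bigcup_(i in setT) U i.
  apply/seteqP; split=> t.
    move=> [t_dir [i [t1 [t2 tE]]]]; exists i => //; split=> //.
    by exists t1, t2.
  by move=> [i _ [t_dir [t1 [t2 tE]]]]; split=> //; exists i, t1, t2.
apply: finite_up_to_iso_bigcup => [|i]; first exact: finite_finset.
apply: finite_up_to_iso_subsingleton => _ _ [_ [t1 [t2 ->]]] [_ [t1' [t2' ->]]].
exact: tpair_unique.
Qed.

End SymbolicPairs.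

End Transformations.

Theorem theorem7 (C : madhesive)
    (E' : forall A1 A2 B : C, hom A1 B -> hom A2 B -> Prop)
    (hE : unique_pair_factorization E')
    (cp : binary_coproducts C)
    (T : ac_transport C)
    (sys : set (rule C))
    (hinit : has_initial_pairs_for_conflicts sys)
    (r1 r2 : rule C) (hr1 : sys r1) (hr2 : sys r2)
    (S : set (stp T r1 r2))
    (hS : is_set_of_initial_conflicts cp S)
    (hreg : forall s, S s -> regular s)
    (F : forall s : stp T r1 r2, disjunctive_form (src s))
    (hF : forall s, S s -> represents (F s)) :
  Mcomplete (\bigcup_(s in S) disjunctive_unfolding (F s)) /\
  (finite_set S ->
   finite_up_to_iso (\bigcup_(s in S) disjunctive_unfolding (F s))).
Proof.
split=> [t t_dir t_dep|S_fin]; last first.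
  apply: finite_up_to_iso_bigcup => // s.
  exact: finite_up_to_iso_disjunctive_unfolding.
have [s0 [s0_init [e0 e0_emb]]] :=
  initial_conflict_embeds T cp (hinit _ _ hr1 hr2 t) t_dir t_dep.
(* [S] may contain only an isomorphic copy of [s0]; inverting the isomorphism lets this copy embed
   into [s0] and hence into [t]. *)
have [s [Ss /tpair_iso_embeds_inv[e e_emb]]] := hS.2 s0 s0_init.
have [t' [Ut' t'_emb]] := disjunctive_unfolding_embeds (hF s Ss)
  (embeds_comp e_emb e0_emb) t_dir t_dep.
by exists t'; split=> //; exists s.
Qed.
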